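(* Let $r\ge 1$, let $G$ be a regular subgroup of $\mathrm{GA}(r,2)$ and let $\tau: F^r\to F^r$ be the permutation induced by an automorphism of the group $G$. Then the code $S'_{\mathcal H,\tau}=\bigcup_{a\in F^r}\mathcal H'_a\times\mathcal H_{\tau(a)}$ is a propelinear perfect binary code of length $2^{r+1}-1$.
   Context: $F=\mathrm{GF}(2)$; $F^n$ is the $n$-dimensional vector space over $F$ with the Hamming metric; a code of length $n$ is a set of vectors of $F^n$, whose elements are called codewords. $\mathrm{wt}$ is Hamming weight. ${\bf 0}$ denotes the all-zero vector. A code $C\subseteq F^n$ is perfect if for every $x\in F^n$ there is exactly one $y\in C$ at Hamming distance at most $1$ from $x$. $\mathrm{Aut}(F^n)$ is the group of all transformations $(x,\pi)$, $x\in F^n$, $\pi$ a permutation of the coordinate positions, acting by $(x,\pi)(y)=x+\pi(y)$ where $\pi(y)=(y_{\pi^{-1}(1)},\ldots,y_{\pi^{-1}(n)})$. $\mathrm{Aut}(C)$ is the setwise stabilizer of $C$ in $\mathrm{Aut}(F^n)$. A group acting on a set is regular if it acts transitively and its order equals the size of the set. A code $C$ is propelinear if $\mathrm{Aut}(C)$ has a subgroup acting regularly on the codewords of $C$. The coordinates of $F^{2^r}$ are indexed by the vectors of $F^r$, and those of $F^{2^r-1}$ by the nonzero vectors of $F^r$; $e_a$ is the vector (in either space) whose only nonzero coordinate is the one indexed by $a$. $\mathcal H=\{c\in F^{2^r}:\sum_{a:c_a=1}a={\bf 0},\ \mathrm{wt}(c)\equiv 0 \pmod 2\}$, and $\mathcal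 H_a=\mathcal H+e_a+e_{\bf 0}$ for $a\in F^r$. $\mathcal H'=\{c\in F^{2^r-1}:\sum_{a:c_a=1}a={\bf 0}\}$ (this is $\mathcal H$ with the coordinate indexed by ${\bf 0}$ deleted), $\mathcal H'_a=e_a+\mathcal H'$ for $a\ne{\bf 0}$, and $\mathcal H'_{\bf 0}=\mathcal H'$. For codes $C,D$, $C\times D=\{x|y: x\in C,\ y\in D\}$, where $x|y$ is concatenation. $\mathrm{GA}(r,2)=\{(a,M):a\in F^r,\ M\in\mathrm{GL}(r,2)\}$ is the general affine group, acting on $F^r$ by $(a,M)(b)=a+Mb$, with composition as group operation. A subgroup $G$ of $\mathrm{GA}(r,2)$ is regular if it acts regularly on the vectors of $F^r$. For such $G$ and $a\in F^r$, $g_a$ denotes the unique element of $G$ mapping ${\bf 0}$ to $a$. The permutation $\tau$ of $F^r$ induced by an automorphism $T$ of the group $G$ is defined by $T(g_a)=g_{\tau(a)}$ for all $a\in F^r$. *)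

(* Defs.v *)
From HB Require Import structures.
From mathcomp Require Import all_boot all_order all_algebra all_fingroup.

Set Implicit Arguments.
Unset Strict Implicit.
Unset Printing Implicit Defensive.

Import GroupScope GRing.Theory.
Local Open Scope ring_scope.

(* The space F^n, with its n coordinates indexed by a finite type I, n = #|I|. *)
Notation word I := {ffun I -> 'F_2}.

(* Permutation groups on a finite type X are groups {group {perm X}} acting by
   the natural action 'P.  The product s * t of {perm X} applies s first,
   i.e. it is the opposite of composition; subgroups, orders, orbits and
   automorphisms are the same for both conventions. *)
Definition acts_regularly (X : finType) (A : {set {perm X}}) (S : {set X}) :=
  [transitive A, on S | 'P] && (#|A| == #|S|).

Section Codes.

Variable I : finType.
Implicit Types (x y c : word I) (C : {set word I}) (s : {perm I}).

Definition wt c := #|[set i | c i != 0]|.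

Definition hdist x y := #|[set i | x i != y i]|.

Definition e_ (a : I) : word I := [ffun i => (i == a)%:R].

Definition perfect C := forall x, exists! y, y \in C /\ (hdist x y <= 1)%N.

Definition permw s y : word I := [ffun i => y (s^-1%g i)].

(* The pairs (x, s) are identified with the maps y |-> x + permw s y, which
   determine them. *)
Definition AutF : {set {perm word I}} :=
  [set f : {perm word I} |
    [exists x : word I, exists s : {perm I}, forall y, f y == x + permw s y]].

Lemma AutF_group_set : group_set AutF.
Proof.
apply/group_setP; split.
  rewrite inE; apply/existsP; exists 0; apply/existsP; exists 1%g.
  apply/forallP => y; rewrite perm1 add0r; apply/eqP/ffunP => i.
  by rewrite ffunE invg1 perm1.
move=> f g; rewrite !inE.
case/existsP=> x /existsP[s /forallP fE] /existsP[x' /existsP[s' /forallP gE]].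
apply/existsP; exists (x' + permw s' x); apply/existsP; exists (s * s')%g.
apply/forallP => y; rewrite permM (eqP (gE _)) (eqP (fE _)).
apply/eqP/ffunP => i; rewrite -addrA !ffunE; congr (_ + (_ + y _)).
by rewrite invMg permM.
Qed.

Canonical AutF_group := Group AutF_group_set.

Definition AutC C : {set {perm word I}} := 'N_AutF(C | 'P).

Definition propelinear C :=
  exists H : {group {perm word I}}, (H \subset AutC C) && acts_regularly H C.

End Codes.

Definition concat (I J : finType) (x : word I) (y : word J) : word (I + J)%type :=
  [ffun k => match k with inl i => x i | inr j => y j end].

Definition code_prod (I J : finType) (C : {set word I}) (D : {set word J}) :
    {set word (I + J)%type} :=
  [set concat x y | x in C, y in D].

Notation nzvec r := {a : 'cV['F_2]_r | a != 0%R}.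

Section Affine.

Variable r : nat.
Notation V := 'cV['F_2]_r.

Definition GA : {set {perm V}} :=
  [set f : {perm V} | [exists a : V, exists M : 'M['F_2]_r,
    (M \in unitmx) && [forall b : V, f b == a + M *m b]]].

Lemma GA_group_set : group_set GA.
Proof.
apply/group_setP; split.
  rewrite inE; apply/existsP; exists 0; apply/existsP; exists 1%:M.
  rewrite unitmx1; apply/forallP => b.
  by rewrite perm1 add0r mul1mx.
move=> f g; rewrite !inE.
case/existsP=> a /existsP[M /andP[uM /forallP fE]].
case/existsP=> b /existsP[N /andP[uN /forallP gE]].
apply/existsP; exists (b + N *m a); apply/existsP; exists (N *m M).
rewrite unitmx_mul uN uM; apply/forallP => c.
by rewrite permM (eqP (gE _)) (eqP (fE _)) mulmxDr mulmxA addrA.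
Qed.

Canonical GA_group := Group GA_group_set.

(* The element g_a of G mapping 0 to a; it exists and is unique when G is
   regular, and the default value 1 is then never used. *)
Definition elt_to (G : {set {perm V}}) (a : V) : {perm V} :=
  odflt 1%g [pick g in G | g 0 == a].

Definition induced_by (G : {set {perm V}}) (T : {perm {perm V}})
    (tau : {perm V}) :=
  forall a : V, T (elt_to G a) = elt_to G (tau a).

Definition extHamming : {set word V} :=
  [set c : word V | (\sum_(a | c a == 1) a == 0) && ~~ odd (wt c)].

Definition extHamming_ (a : V) : {set word V} :=
  [set c + e_ a + e_ (0 : V) | c : word V in extHamming].

Definition Hamming : {set word (nzvec r)} :=
  [set c : word (nzvec r) | \sum_(a | c a == 1) val a == 0].

(* insub a is Some a (seen as a nonzero vector) if a != 0, and None if a = 0. *)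
Definition Hamming_ (a : V) : {set word (nzvec r)} :=
  if insub a is Some a' then [set e_ a' + c | c : word (nzvec r) in Hamming] else Hamming.

Definition S' (tau : {perm V}) : {set word (nzvec r + V)%type} :=
  \bigcup_(a : V) code_prod (Hamming_ a) (extHamming_ (tau a)).

End Affine.

(* Main.v *)
(* Call syn'(w), syn(w) the sums of the coordinate labels over the supports of
   the two halves of w = x|y.  Then w lies in S' iff wt(y) is even and
   syn(w) = tau(syn'(w)).  Perfectness: if wt(y) is even, only a change in x (or
   no change) can lead into S', and the label of the coordinate to change is
   forced; if wt(y) is odd, only a change in y can, with the same conclusion.
   Propelinearity: for c in S' with a = syn'(c), put
   phi_c(w) = c + pi_a(w), where pi_a acts on the labels of x by the linear part
   of g_a and on those of y by g_(tau a).  Then syn'(phi_c(w)) = g_a(syn'(w))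
   and, on words of even weight in y, syn(phi_c(w)) = g_(tau a)(syn(w)); since
   tau is induced by an automorphism, tau g_a = g_(tau a) tau, so phi_c preserves
   S' and phi_c phi_d = phi_(phi_c(d)).  As phi_c(0) = c, these maps form a
   regular group. *)

Require Import Defs.
From mathcomp Require Import all_boot all_order all_algebra all_fingroup.

Set Implicit Arguments.
Unset Strict Implicit.
Unset Printing Implicit Defensive.

Import GroupScope GRing.Theory.
Local Open Scope ring_scope.

(** * Arithmetic over GF(2), sums over supports, words at distance at most 1 *)

Lemma F2_cases (a : 'F_2) : a = 0 \/ a = 1.
Proof. by case: a => [[|[|//]] i]; [left|right]; apply/val_inj. Qed.

Lemma F2_addxx (a : 'F_2) : a + a = 0.
Proof. by case: (F2_cases a) => ->; apply/val_inj. Qed.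

Lemma F2_neq (a b : 'F_2) : a != b -> b = a + 1.
Proof.
by case: (F2_cases a) => ->; case: (F2_cases b) => ->; rewrite ?eqxx // => _;
   apply/val_inj.
Qed.

Lemma F2_lmod_addxx (U : lmodType 'F_2) (u : U) : u + u = 0.
Proof. by rewrite -[u]scale1r -scalerDl F2_addxx scale0r. Qed.

Lemma F2_lmod_addKx (U : lmodType 'F_2) (u v : U) : u + (u + v) = v.
Proof. by rewrite addrA F2_lmod_addxx add0r. Qed.

Lemma word_addxx (I : finType) (x : word I) : x + x = 0.
Proof. by apply/ffunP => i; rewrite !ffunE F2_addxx. Qed.

(** Turns a support sum into an expression additive in [x]. *)
Lemma sum_support_F2 (I : finType) (U : lmodType 'F_2) (x : word I) (F : I -> U) :
  \sum_(i | x i == 1) F i = \sum_i x i *: F i.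
Proof.
rewrite big_mkcond; apply: eq_bigr => i _.
by case: (F2_cases (x i)) => ->; rewrite ?eqxx ?scale1r ?scale0r.
Qed.

Lemma odd_wt (I : finType) (x : word I) : ~~ odd (wt x) = (\sum_i x i == 0).
Proof.
have -> : \sum_i x i = (wt x)%:R :> 'F_2.
  rewrite /wt -sum1_card natr_sum [RHS]big_mkcond; apply: eq_bigr => i _.
  by rewrite inE; case: (F2_cases (x i)) => ->.
by rewrite -(dvdn_pcharf (pchar_Fp (isT : prime 2))) dvdn2.
Qed.

Lemma sum_delta (I : finType) (U : lmodType 'F_2) (F : I -> U) (i : I) :
  \sum_j (j == i)%:R *: F j = F i.
Proof.
by rewrite (bigD1 i) //= eqxx scale1r big1 ?addr0 // => j /negbTE->; rewrite scale0r.
Qed.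

Lemma sum_add_e (I : finType) (U : lmodType 'F_2) (F : I -> U) (x : word I) (i : I) :
  \sum_j (x + e_ i) j *: F j = \sum_j x j *: F j + F i.
Proof.
under eq_bigr do rewrite !ffunE scalerDl.
by rewrite big_split /= sum_delta.
Qed.

Lemma hdistxx (I : finType) (x : word I) : hdist x x = 0.
Proof. by apply/eqP; rewrite cards_eq0; apply/eqP/setP => i; rewrite !inE eqxx. Qed.

Lemma hdist_le1 (I : finType) (x y : word I) :
  reflect (x = y \/ exists i, y = x + e_ i) (hdist x y <= 1)%N.
Proof.
apply: (iffP idP) => [|[<-|[i ->]]].
- rewrite leq_eqVlt ltnS leqn0 => /orP[/cards1P[i Di]|]; last first.
    rewrite cards_eq0 => /eqP/setP D0; left; apply/ffunP => i.
    by have := D0 i; rewrite !inE => /negbFE/eqP.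
  right; exists i; apply/ffunP => j; rewrite !ffunE.
  have := erefl (j \in [set i]); rewrite -{1}Di !inE => <-.
  by case: eqP => [->|/eqP/F2_neq]; rewrite ?addr0.
- by rewrite hdistxx.
apply: leq_trans (eq_leq (cards1 i)); apply/subset_leq_card/subsetP => j.
rewrite !inE !ffunE.
by apply: contraNT => /negbTE->; rewrite addr0.
Qed.

(** * Coordinate permutations acting on words *)

Section PermutedWords.

Variable I : finType.
Implicit Types (x y : word I) (s t : {perm I}).

Lemma permwD s x y : permw s (x + y) = permw s x + permw s y.
Proof. by apply/ffunP => i; rewrite !ffunE. Qed.

Lemma permw0 s : permw s 0 = 0.
Proof. by apply/ffunP => i; rewrite !ffunE. Qed.

Lemma permw1 x : permw 1 x = x.
Proof. by apply/ffunP => i; rewrite ffunE invg1 perm1. Qed.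

Lemma permwM s t x : permw (s * t)%g x = permw t (permw s x).
Proof. by apply/ffunP => i; rewrite !ffunE invMg permM. Qed.

Lemma permw_inj s : injective (permw s).
Proof. by apply: (can_inj (g := permw s^-1)) => x; rewrite -permwM mulgV permw1. Qed.

End PermutedWords.

(** * Linear parts of affine maps *)

Section LinearPart.

Variable r : nat.
Local Notation V := 'cV['F_2]_r.
Implicit Types (g h : {perm V}) (a b : V).

(** In characteristic 2, [g 0 + g v] is the linear part of [g] applied to [v]. *)
Lemma GA_comb g (I : finType) (c : I -> 'F_2) (v : I -> V) :
  g \in GA r ->
  g (\sum_i c i *: v i) = g 0 + \sum_i c i *: (g 0 + g (v i)).
Proof.
rewrite inE => /existsP[a /existsP[M /andP[_ /forallP gE]]].
rewrite !(eqP (gE _)) mulmx0 addr0 mulmx_sumr; congr (_ + _).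
by apply: eq_bigr => i _; rewrite (eqP (gE _)) F2_lmod_addKx scalemxAr.
Qed.

(** The number of summands is odd, so exactly one copy of the translation part survives. *)
Lemma GA_add3 g a b c : g \in GA r -> g (a + b + c) = g a + g b + g c.
Proof.
rewrite inE => /existsP[u /existsP[M /andP[_ /forallP gE]]].
rewrite !(eqP (gE _)) !mulmxDr [u + M *m a + _]addrACA F2_lmod_addxx add0r.
by rewrite [RHS]addrCA.
Qed.

(** The default [b] is never taken: [g] is injective and [val b] is nonzero, so the sum is
    nonzero. *)
Definition nzact_fun g (b : nzvec r) : nzvec r := insubd b (g 0 + g (val b)).

Lemma val_nzact_fun g (b : nzvec r) : val (nzact_fun g b) = g 0 + g (val b).
Proof.
rewrite val_insubd; case: ifPn => // /negPn/eqP gb0.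
have: g (val b) = g 0 by rewrite -[LHS](F2_lmod_addKx (g 0)) gb0 addr0.
by move/perm_inj => b0; have := valP b; rewrite b0 eqxx.
Qed.

Lemma nzact_inj g : injective (nzact_fun g).
Proof.
move=> b c /(congr1 val); rewrite !val_nzact_fun => /addrI/perm_inj.
exact: val_inj.
Qed.

(* For an affine g this is the action of its linear part g(0) + g. *)
Definition nzact g : {perm nzvec r} := perm (@nzact_inj g).

Lemma val_nzact g (b : nzvec r) : val (nzact g b) = g 0 + g (val b).
Proof. by rewrite permE val_nzact_fun. Qed.

Lemma nzact1 : nzact 1 = 1%g.
Proof. by apply/permP => b; apply/val_inj; rewrite val_nzact !perm1 add0r. Qed.

Lemma nzactM g h : h \in GA r -> nzact (g * h) = (nzact g * nzact h)%g.
Proof.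
move=> hGA; apply/permP => b; apply/val_inj.
(* Padding with 0 makes three summands; the extra [h 0] then cancels. *)
rewrite permM !val_nzact !permM -[g 0 in RHS]add0r GA_add3 //.
by rewrite !addrA F2_lmod_addxx add0r.
Qed.

End LinearPart.

(** * Permutations acting separately on two blocks of coordinates *)

Section SumPerm.

Variables I J : finType.
Implicit Types (s : {perm I}) (t : {perm J}).

Definition sum_perm_fun s t (k : I + J) : I + J :=
  match k with inl i => inl (s i) | inr j => inr (t j) end.

Lemma sum_perm_inj s t : injective (sum_perm_fun s t).
Proof. by move=> [i|j] [i'|j'] //= [] /perm_inj->. Qed.

Definition sum_perm s t : {perm I + J} := perm (@sum_perm_inj s t).

Lemma sum_perm1 : sum_perm 1 1 = 1%g.
Proof. by apply/permP => -[i|j]; rewrite permE /= !perm1. Qed.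

Lemma sum_permM s s' t t' :
  sum_perm (s * s') (t * t') = (sum_perm s t * sum_perm s' t')%g.
Proof. by apply/permP => -[i|j]; rewrite permM !permE /= permM. Qed.

(** For weighted sums, permuting a word amounts to relabelling its coordinates. *)
Lemma sum_permw_inl (U : lmodType 'F_2) (F : I -> U) s t (w : word (I + J)%type) :
  \sum_i permw (sum_perm s t) w (inl i) *: F i = \sum_i w (inl i) *: F (s i).
Proof.
rewrite (reindex_inj (@perm_inj _ s)); apply: eq_bigr => i _; rewrite ffunE.
suff -> : inl (s i) = sum_perm s t (inl i) by rewrite permK.
by rewrite permE.
Qed.

Lemma sum_permw_inr (U : lmodType 'F_2) (F : J -> U) s t (w : word (I + J)%type) :
  \sum_j permw (sum_perm s t) w (inr j) *: F j = \sum_j w (inr j) *: F (t j).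
Proof.
rewrite (reindex_inj (@perm_inj _ t)); apply: eq_bigr => j _; rewrite ffunE.
suff -> : inr (t j) = sum_perm s t (inr j) by rewrite permK.
by rewrite permE.
Qed.

End SumPerm.

Lemma card_nzvec_sum r : #|{: nzvec r + 'cV['F_2]_r}| = (2 ^ r.+1 - 1)%N.
Proof.
rewrite card_sum card_sig cardC1 card_mx card_Fp // muln1 expnS.
by case: (2 ^ r)%N (expn_gt0 2 r) => // n _; rewrite mul2n -addnn subn1.
Qed.

(** * Syndromes, membership in the code, perfectness *)

Section Syndromes.

Variable r : nat.
Local Notation V := 'cV['F_2]_r.
Local Notation W := (word (nzvec r + V)%type).
Implicit Types (w : W) (tau : {perm V}).

Definition syn' w : V := \sum_(i : nzvec r) w (inl i) *: val i.
Definition syn w : V := \sum_(a : V) w (inr a) *: a.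
(* Scaling the constant 1 gives the parity the same shape as the syndromes, so
   that sum_permw_inr, sum_delta and sum_add_e apply to all three. *)
Definition par w : ('F_2)^o := \sum_(a : V) w (inr a) *: (1 : ('F_2)^o).

Lemma syn'D w z : syn' (w + z) = syn' w + syn' z.
Proof. by rewrite -big_split; apply: eq_bigr => i _; rewrite ffunE scalerDl. Qed.
Lemma synD w z : syn (w + z) = syn w + syn z.
Proof. by rewrite -big_split; apply: eq_bigr => i _; rewrite ffunE scalerDl. Qed.
Lemma parD w z : par (w + z) = par w + par z.
Proof. by rewrite -big_split; apply: eq_bigr => i _; rewrite ffunE scalerDl. Qed.

Lemma syn'0 : syn' 0 = 0.
Proof. by apply: big1 => i _; rewrite ffunE scale0r. Qed.
Lemma syn0 : syn 0 = 0.
Proof. by apply: big1 => i _; rewrite ffunE scale0r. Qed.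
Lemma par0 : par 0 = 0.
Proof. by apply: big1 => i _; rewrite ffunE scale0r. Qed.

Lemma syn'_el (b : nzvec r) : syn' (e_ (inl b)) = val b.
Proof.
rewrite -(sum_delta (fun i : nzvec r => val i) b).
by apply: eq_bigr => i _; rewrite ffunE.
Qed.
Lemma syn'_er a : syn' (e_ (inr a)) = 0.
Proof. by apply: big1 => i _; rewrite ffunE scale0r. Qed.
Lemma syn_el (b : nzvec r) : syn (e_ (inl b)) = 0.
Proof. by apply: big1 => i _; rewrite ffunE scale0r. Qed.
Lemma syn_er a : syn (e_ (inr a)) = a.
Proof. by rewrite -[RHS](sum_delta id); apply: eq_bigr => i _; rewrite ffunE. Qed.
Lemma par_el (b : nzvec r) : par (e_ (inl b)) = 0.
Proof. by apply: big1 => i _; rewrite ffunE scale0r. Qed.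
Lemma par_er a : par (e_ (inr a)) = 1.
Proof.
rewrite -[RHS](sum_delta (fun=> (1 : ('F_2)^o)) a).
by apply: eq_bigr => i _; rewrite ffunE.
Qed.

(** The cosets are the syndrome classes: adding [e_ a'] shifts the syndrome by [a']. *)
Lemma mem_Hamming_ (a : V) (x : word (nzvec r)) :
  (x \in Hamming_ a) = (\sum_i x i *: val i == a).
Proof.
have E0 (y : word (nzvec r)) : (y \in Hamming r) = (\sum_i y i *: val i == 0).
  by rewrite inE sum_support_F2.
rewrite /Hamming_; case: insubP => [a' _ <-|/negPn/eqP-> //].
apply/imsetP/eqP => [[c] | xa].
  by rewrite E0 addrC => /eqP c0 ->; rewrite sum_add_e c0 add0r.
exists (x + e_ a'); first by rewrite E0 sum_add_e xa F2_lmod_addxx.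
by rewrite addrC -addrA word_addxx addr0.
Qed.

Lemma mem_extHamming_ (a : V) (y : word V) :
  (y \in extHamming_ a) =
    (\sum_b y b *: (1 : ('F_2)^o) == 0) && (\sum_b y b *: b == a).
Proof.
have E0 (z : word V) : (z \in extHamming r) =
    (\sum_b z b *: (1 : ('F_2)^o) == 0) && (\sum_b z b *: b == 0).
  rewrite inE odd_wt sum_support_F2 andbC; congr (_ && _).
  by congr (_ == _); apply: eq_bigr => b _; rewrite [RHS]mulr1.
apply/imsetP/andP => [[c] | [/eqP y0 /eqP ya]].
  rewrite E0 => /andP[/eqP c0 /eqP c1] ->.
  by rewrite !sum_add_e c0 c1 !add0r addr0 F2_lmod_addxx.
(* Translation by [e_ a + e_ 0] is its own inverse; it keeps the parity and shifts the syndrome by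
   [a]. *)
exists (y + e_ a + e_ 0).
  by rewrite E0 !sum_add_e y0 ya add0r addr0 !F2_lmod_addxx !eqxx.
by rewrite -!addrA [e_ 0 + _]addrCA !word_addxx !addr0 word_addxx addr0.
Qed.

(** The index [a] of the union can only be the syndrome of the first half. *)
Lemma mem_S' tau w : (w \in S' tau) = (par w == 0) && (syn w == tau (syn' w)).
Proof.
apply/bigcupP/idP => [[a _ /imset2P[x y]] | wS].
  rewrite mem_Hamming_ mem_extHamming_ => /eqP xa /andP[/eqP y0 /eqP ya] ->.
  have -> : par (concat x y) = 0.
    by rewrite -[RHS]y0; apply: eq_bigr => i _; rewrite ffunE.
  have -> : syn (concat x y) = tau a.
    by rewrite -[RHS]ya; apply: eq_bigr => i _; rewrite ffunE.
  have -> : syn' (concat x y) = a.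
    by rewrite -[RHS]xa; apply: eq_bigr => i _; rewrite ffunE.
  by rewrite !eqxx.
exists (syn' w) => //; apply/imset2P.
exists [ffun i => w (inl i)] [ffun i => w (inr i)].
- by rewrite mem_Hamming_; apply/eqP/eq_bigr => i _; rewrite ffunE.
- apply: etrans wS; rewrite mem_extHamming_.
  by congr (_ && _); congr (_ == _); apply: eq_bigr => i _; rewrite ffunE.
by apply/ffunP => -[i|i]; rewrite !ffunE.
Qed.

Lemma perfect_S' tau : perfect (S' tau).
Proof.
move=> w; case: (F2_cases (par w)) => pw.
  (* The required change of [syn'] while [syn] stays fixed; it is 0 exactly when [w] is itself a
     codeword. *)
  set d := syn' w + tau^-1%g (syn w).
  have memP z : reflect (z = w + (if insub d is Some b then e_ (inl b) else 0))
                        ((z \in S' tau) && (hdist w z <= 1)%N).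
    apply: (iffP andP) => [[]|->].
      rewrite mem_S' => /andP[/eqP pz /eqP sz] /hdist_le1 zw.
      have {}sz : syn' z = tau^-1%g (syn z) by rewrite sz permK.
      case: zw pz sz => [<- _ sw|[[b|a] ->]].
      - by rewrite /d -sw F2_lmod_addxx insubF ?eqxx // addr0.
      - rewrite syn'D synD syn'_el syn_el addr0 => _ sw.
        have -> : d = val b by rewrite /d -sw F2_lmod_addKx.
        by rewrite valK.
      by rewrite parD par_er pw add0r => /eqP; rewrite oner_eq0.
    case: insubP => [b _ db|/negPn/eqP d0].
      split; last by apply/hdist_le1; right; exists (inl b).
      rewrite mem_S' parD synD syn'D par_el syn_el syn'_el pw !addr0 eqxx /=.
      by rewrite db F2_lmod_addKx permKV.
    rewrite addr0 hdistxx; split=> //; rewrite mem_S' pw eqxx /=.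
    have -> : syn' w = tau^-1%g (syn w).
      by rewrite -[RHS](F2_lmod_addKx (syn' w)) -/d d0 addr0.
    by rewrite permKV.
  (* [memP] reduces membership to an equation for [z], giving both existence and uniqueness. *)
  eexists; split; first by apply/andP/memP.
  by move=> z /andP/memP.
(* Here [d] may be 0: the second half has a coordinate labelled 0, and the odd parity forces a flip
   in any case. *)
set d := syn w + tau (syn' w).
have memP z : reflect (z = w + e_ (inr d)) ((z \in S' tau) && (hdist w z <= 1)%N).
  apply: (iffP andP) => [[]|->].
    rewrite mem_S' => /andP[/eqP pz /eqP sz] /hdist_le1 zw.
    case: zw pz sz => [<-|[[b|a] ->]].
    - by rewrite pw => /eqP; rewrite oner_eq0.
    - by rewrite parD par_el pw addr0 => /eqP; rewrite oner_eq0.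
    rewrite syn'D synD syn'_er syn_er addr0 => _ sw.
    by rewrite /d -sw F2_lmod_addKx.
  split; last by apply/hdist_le1; right; exists (inr d).
  rewrite mem_S' parD synD syn'D par_er syn_er syn'_er pw !addr0 F2_addxx eqxx /=.
  by rewrite /d F2_lmod_addKx.
eexists; split; first by apply/andP/memP.
by move=> z /andP/memP.
Qed.

(** The first half has no label 0, so a label action there has to fix 0, hence the linear part; the
    second half has all labels, so [h] itself acts. *)
Definition coord_act (g h : {perm V}) := sum_perm (nzact g) h.

Lemma syn'_coord_act g h w :
  g \in GA r -> g 0 + syn' (permw (coord_act g h) w) = g (syn' w).
Proof.
move=> gGA; rewrite /syn' sum_permw_inl GA_comb //.
by congr (_ + _); apply: eq_bigr => i _; rewrite val_nzact.
Qed.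

Lemma par_coord_act g h w : par (permw (coord_act g h) w) = par w.
Proof. by rewrite /par sum_permw_inr. Qed.

Lemma syn_coord_act g h w :
  h \in GA r -> par w = 0 -> h 0 + syn (permw (coord_act g h) w) = h (syn w).
Proof.
move=> hGA pw; rewrite /syn sum_permw_inr GA_comb //; congr (_ + _).
under [RHS]eq_bigr do rewrite scalerDr.
rewrite big_split /= -scaler_suml.
(* The copies of [h 0], one for each coordinate in the support, cancel by even parity. *)
suff -> : \sum_i w (inr i) = 0 by rewrite scale0r add0r.
by rewrite -[RHS]pw; apply: eq_bigr => i _; rewrite [RHS]mulr1.
Qed.

End Syndromes.

(** * The regular group of transformations of the code *)

Section RegularAction.

Variables (r : nat) (G : {group {perm 'cV['F_2]_r}}).
Hypothesis hGA : G \subset GA r.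
Hypothesis hreg : acts_regularly G [set: 'cV['F_2]_r].
Local Notation V := 'cV['F_2]_r.
Implicit Types (a b : V) (g : {perm V}).

Lemma elt_to_spec a : elt_to G a \in G /\ elt_to G a 0 = a.
Proof.
rewrite /elt_to; case: pickP => [g /andP[gG /eqP //]|none].
have /andP[tr _] := hreg.
have /orbitP[g gG g0] : a \in orbit 'P G 0.
  by rewrite (atransP tr) inE.
by have := none g; rewrite gG /= -[g 0]/('P%act 0 g) g0 eqxx.
Qed.

(** By counting: [elt_to G] injects the vectors into [G], which has the same size, so it is onto. *)
Lemma elt_toE g : g \in G -> elt_to G (g 0) = g.
Proof.
have /andP[_ /eqP cG] := hreg.
have elt_inj : injective (elt_to G).
  by move=> a b eab; rewrite -(elt_to_spec a).2 eab (elt_to_spec b).2.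
have imG : elt_to G @: [set: V] = G.
  apply/eqP; rewrite eqEcard card_imset // cG leqnn andbT.
  by apply/subsetP => _ /imsetP[a _ ->]; case: (elt_to_spec a).
rewrite -{1}imG => /imsetP[a _ ->].
by rewrite (elt_to_spec a).2.
Qed.

Lemma elt_to0 : elt_to G 0 = 1%g.
Proof. by rewrite -[in LHS](perm1 (0 : V)) elt_toE. Qed.

(** Both sides lie in [G] and agree at 0, the product applying its left factor first. *)
Lemma elt_toM a b : elt_to G (elt_to G b a) = (elt_to G a * elt_to G b)%g.
Proof.
have [[aG a0] [bG b0]] := (elt_to_spec a, elt_to_spec b).
by rewrite -(elt_toE (groupM aG bG)) permM a0.
Qed.

Lemma elt_to_GA a : elt_to G a \in GA r.
Proof. exact: subsetP hGA _ (elt_to_spec a).1. Qed.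

Variables (T : {perm {perm V}}) (tau : {perm V}).
Hypothesis hT : T \in Aut G.
Hypothesis htau : induced_by G T tau.

Lemma tau_elt_to a b : tau (elt_to G b a) = elt_to G (tau b) (tau a).
Proof.
have [[aG _] [bG _]] := (elt_to_spec a, elt_to_spec b).
have TM := morphicP (Aut_morphic hT) _ _ aG bG.
(* Any value [tau x] is the image of 0 under [T (elt_to G x)], so multiplicativity of [T] passes to
   [tau]. *)
rewrite -[LHS](elt_to_spec _).2 -htau elt_toM TM !htau permM.
by rewrite (elt_to_spec (tau a)).2.
Qed.

Lemma tau0 : tau 0 = 0.
Proof.
rewrite -[LHS](elt_to_spec _).2 -htau elt_to0.
by rewrite -(autmE hT) morph1 perm1.
Qed.

Local Notation W := (word (nzvec r + V)%type).
Implicit Types c w : W.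

Definition codeperm c := coord_act (elt_to G (syn' c)) (elt_to G (tau (syn' c))).

Definition transl_fun c w := c + permw (codeperm c) w.

Lemma transl_inj c : injective (transl_fun c).
Proof. by move=> w z /addrI/permw_inj. Qed.

Definition transl c : {perm W} := perm (@transl_inj c).

Lemma translE c w : transl c w = c + permw (codeperm c) w.
Proof. by rewrite permE. Qed.

Lemma translx0 c : transl c 0 = c.
Proof. by rewrite translE permw0 addr0. Qed.

Lemma syn'_transl c w : syn' (transl c w) = elt_to G (syn' c) (syn' w).
Proof.
rewrite translE syn'D -(syn'_coord_act (elt_to G (tau (syn' c)))) ?elt_to_GA //.
by rewrite (elt_to_spec _).2.
Qed.

Lemma transl_S' c w : c \in S' tau -> w \in S' tau -> transl c w \in S' tau.
Proof.
rewrite !mem_S' => /andP[/eqP pc /eqP sc] /andP[/eqP pw /eqP sw].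
rewrite syn'_transl tau_elt_to translE parD synD par_coord_act pc pw addr0 eqxx /=.
rewrite sc -{1}(elt_to_spec (tau (syn' c))).2.
by rewrite syn_coord_act ?elt_to_GA // sw.
Qed.

(** [codeperm] depends only on [syn'], on which [transl c] acts as an element of [G]; this yields
    closure under products. *)
Lemma codeperm_transl c w :
  codeperm (transl c w) = (codeperm w * codeperm c)%g.
Proof.
rewrite /codeperm syn'_transl tau_elt_to !elt_toM /coord_act nzactM ?elt_to_GA //.
by rewrite sum_permM.
Qed.

Lemma transl0 : transl 0 = 1%g.
Proof.
apply/permP => w; rewrite translE perm1 add0r /codeperm syn'0 tau0 elt_to0.
by rewrite /coord_act nzact1 sum_perm1 permw1.
Qed.

Lemma translM c d : (transl c * transl d)%g = transl (transl d c).
Proof.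
apply/permP => w; rewrite permM [RHS]translE codeperm_transl permwM.
by rewrite !translE permwD addrA.
Qed.

Lemma S'_0 : 0 \in S' tau.
Proof. by rewrite mem_S' par0 syn0 syn'0 tau0 !eqxx. Qed.

Lemma transl_group_set : group_set (transl @: S' tau).
Proof.
apply/group_setP; split; first by rewrite -transl0 imset_f ?S'_0.
move=> _ _ /imsetP[c cS ->] /imsetP[d dS ->].
by rewrite translM imset_f ?transl_S'.
Qed.

Lemma transl_AutC c : c \in S' tau -> transl c \in AutC (S' tau).
Proof.
move=> cS; rewrite inE; apply/andP; split.
  rewrite inE; apply/existsP; exists c; apply/existsP; exists (codeperm c).
  by apply/forallP => w; rewrite translE.
rewrite !inE; apply/subsetP => w wS; rewrite inE.
exact: transl_S'.
Qed.

Lemma propelinear_S' : propelinear (S' tau).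
Proof.
exists (Group transl_group_set); apply/andP; split.
  by apply/subsetP => _ /imsetP[c cS ->]; apply: transl_AutC.
apply/andP; split; last first.
  (* The image of 0 recovers [c], so the group has as many elements as the code. *)
  apply/eqP/card_imset => c d ecd.
  by rewrite -[c]translx0 ecd translx0.
apply/imsetP; exists 0; first exact: S'_0.
apply/setP => w; apply/idP/orbitP => [wS|[_ /imsetP[c cS ->] <-]].
  by exists (transl w); [exact: imset_f | exact: translx0].
exact: (transl_S' cS S'_0).
Qed.

End RegularAction.

Theorem corollary1 (r : nat) (hr : (1 <= r)%N)
    (G : {group {perm 'cV['F_2]_r}}) (hGA : G \subset GA r)
    (hreg : acts_regularly G [set: 'cV['F_2]_r])
    (T : {perm {perm 'cV['F_2]_r}}) (hT : T \in Aut G)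
    (tau : {perm 'cV['F_2]_r}) (htau : induced_by G T tau) :
  [/\ #|{: nzvec r + 'cV['F_2]_r}| = (2 ^ r.+1 - 1)%N,
      perfect (S' tau) & propelinear (S' tau)].
Proof.
split; first exact: card_nzvec_sum.
  exact: perfect_S'.
exact: (propelinear_S' hGA hreg hT htau).
Qed.
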